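(* Let $k>2$ be an integer. The automorphism group of the folded hyper-star graph $FHS(2k,k)$ is identical to the automorphism group of the hyper-star graph $HS(2k,k)$; that is, $\mathrm{Aut}(FHS(2k,k))=\mathrm{Aut}(HS(2k,k))$ as groups of permutations of the common vertex-set of these two graphs.
   Context: Hyper-star graph: let $X=\{1,2,\dots,2k\}$. The graph $HS(2k,k)$ is the simple undirected graph whose vertex-set is the set of all $k$-element subsets of $X$, where two vertices $v,w$ are adjacent if and only if $|v\cap w|=k-1$ and the element $1$ belongs to exactly one of $v$ and $w$. Folded hyper-star graph: $FHS(2k,k)$ is the graph with the same vertex-set $V_1$ as $HS(2k,k)$ and with edge-set $E_1\cup\{\{v,v^c\}\mid v\in V_1\}$, where $E_1$ is the edge-set of $HS(2k,k)$ and $v^c=X\setminus v$ is the complement of $v$ in $X$. *)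

(* Defs.v *)
From mathcomp Require Import all_boot all_fingroup.

Set Implicit Arguments.
Unset Strict Implicit.
Unset Printing Implicit Defensive.

(* A simple graph on a finite type [T] is given by its adjacency relation,
   a symmetric and irreflexive [rel T]. *)

Section GraphAut.
Variables (T : finType) (e : rel T).

Definition graph_aut_set : {set {perm T}} :=
  [set s : {perm T} | [forall u, forall v, e (s u) (s v) == e u v]].

Lemma graph_autP (s : {perm T}) :
  reflect (forall u v, e (s u) (s v) = e u v) (s \in graph_aut_set).
Proof.
rewrite inE; apply: (iffP forallP) => [h u v|h u].
  by apply/eqP; apply: (forallP (h u)).
by apply/forallP => v; apply/eqP.
Qed.

Lemma graph_aut_group_set : group_set graph_aut_set.
Proof.
apply/group_setP; split => [|s t /graph_autP hs /graph_autP ht].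
  by apply/graph_autP => u v; rewrite !perm1.
by apply/graph_autP => u v; rewrite !permM ht hs.
Qed.

Definition graph_aut : {group {perm T}} := Group graph_aut_group_set.

End GraphAut.

(* The ordinal [i : 'I_(2 * k)] stands for the element [i + 1] of
   X = {1, ..., 2k}; in particular the element 1 is the ordinal of value 0. *)
Definition hs_vertex (k : nat) : Type := {v : {set 'I_(2 * k)} | #|v| == k}.

Definition contains1 (k : nat) (v : {set 'I_(2 * k)}) : bool :=
  [exists i in v, val i == 0].

Definition HS (k : nat) : rel (hs_vertex k) := fun v w =>
  (#|val v :&: val w| == k - 1)
  && (contains1 (val v) (+) contains1 (val w)).

Definition FHS (k : nat) : rel (hs_vertex k) := fun v w =>
  HS v w || (val w == ~: val v).

Lemma HS_sym (k : nat) : symmetric (@HS k).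
Proof. by move=> v w; rewrite /HS setIC addbC. Qed.

Lemma HS_irrefl (k : nat) : irreflexive (@HS k).
Proof. by move=> v; rewrite /HS addbb andbF. Qed.

Lemma FHS_sym (k : nat) : symmetric (@FHS k).
Proof.
move=> v w; rewrite /FHS HS_sym; congr (_ || _).
by rewrite eq_sym -(inj_eq (@setC_inj _)) setCK.
Qed.

Lemma FHS_irrefl (k : nat) : 0 < k -> irreflexive (@FHS k).
Proof.
move=> k0 v; rewrite /FHS HS_irrefl /=; apply/negbTE/eqP => h.
have /eqP hv := valP v; have : 0 < #|val v| by rewrite hv.
case/card_gt0P => x xv; have : x \in ~: val v by rewrite -h.
by rewrite inE xv.
Qed.

(* Main.v *)
Require Import Defs.
From mathcomp Require Import all_boot all_fingroup.
From mathcomp Require Import zify.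

(** Write 1 for the distinguished point of X and Y for X without 1.  A vertex v is
    determined by its trace on Y, a subset of size k - 1 or k, so the vertices
    form the two middle layers of the cube of subsets of the (2k-1)-set Y.  Let
    [ydist v w] be the Hamming distance of the traces.  Two vertices are
    adjacent in HS exactly when [ydist] is 1 ([HS_ydist]) and complementary
    exactly when [ydist] is 2k - 1 ([compl_ydist]).  Both inclusions hold because
    complementarity can be recovered from either graph.

    From HS: the middle layers are isometric in the cube, as one can always
    approach a target by an HS-edge ([HS_approach]).  So [ydist] is the graph
    distance of HS, and the complement of v is the only vertex at the maximal
    distance 2k - 1 ([compl_HS_distance]).

    From FHS: an edge v w is complementary when it forms a 4-cycle with every
    other edge at v.  If w is the complement of v and u is another neighbour of
    v, the complement of u closes a 4-cycle v, u, u^c, w.  If instead v w is an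
    HS-edge, choose an HS-neighbour u of v at [ydist] 2 from w.  A common
    neighbour of u and w other than v cannot be reached by HS-edges only, since v
    is the unique one ([HS_common_neighbour_unique]), nor by one HS-edge and one
    complementary edge, since taking complements turns distance 2 into 2k - 3,
    which differs from 1 when k > 2, nor by two complementary edges, since u and
    w are distinct.  See [compl_FHS_squares].

    As HS and complementarity are disjoint relations whose union is FHS, an
    automorphism of either graph preserves the other. *)

Set Implicit Arguments.
Unset Strict Implicit.
Unset Printing Implicit Defensive.

(** * Relations invariant under graph automorphisms *)

Section Invariance.
Variables (T : finType) (e : rel T).

(** An automorphism group is closed under inverses, so a relation that its
    members preserve is also reflected by them. *)
Lemma graph_aut_invariant (r : rel T) :
  (forall s, s \in graph_aut e -> forall v w, r v w -> r (s v) (s w)) ->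
  forall s, s \in graph_aut e -> forall v w, r (s v) (s w) = r v w.
Proof.
move=> r_stable s sA v w; apply/idP/idP => [r_s|]; last exact: r_stable.
have sVA : (s^-1)%g \in graph_aut e by rewrite groupV.
by have := r_stable _ sVA _ _ r_s; rewrite !permK.
Qed.

Lemma graph_aut_path (s : {perm T}) v p :
  s \in graph_aut e -> path e (s v) (map s p) = path e v p.
Proof.
move=> /graph_autP sA; elim: p v => //= u p IHp v.
by rewrite sA IHp.
Qed.

End Invariance.

(** * Vertices and complements *)

Section HyperStar.
Variables (k : nat) (k_gt0 : 0 < k).

Lemma ground_gt0 : 0 < 2 * k. Proof. by rewrite muln_gt0. Qed.

Definition one : 'I_(2 * k) := Ordinal ground_gt0.

Implicit Types u v w t : hs_vertex k.

Lemma contains1E (A : {set 'I_(2 * k)}) : contains1 A = (one \in A).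
Proof.
apply/existsP/idP => [[i /andP[iA /eqP i0]]|oneA]; last by exists one; rewrite oneA.
by rewrite (_ : one = i) //; apply: val_inj.
Qed.

Lemma card_vertex v : #|val v| = k. Proof. apply/eqP; exact: (valP v). Qed.

Lemma card_compl v : #|~: val v| == k.
Proof. by rewrite cardsCs setCK card_ord card_vertex; lia. Qed.

Lemma card_sum_mem (A : {set 'I_(2 * k)}) : #|A| = \sum_i (i \in A).
Proof. by rewrite -sum1_card big_mkcond; apply: eq_bigr => i _; case: ifP. Qed.

Definition compl v : hs_vertex k := exist _ (~: val v) (card_compl v).

(** * The Hamming distance of the traces *)

Definition ydist v w : nat :=
  \sum_(i | i != one) ((i \in val v) (+) (i \in val w)).

Lemma ydistC v w : ydist v w = ydist w v.
Proof. by apply: eq_bigr => i _; rewrite addbC. Qed.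

Lemma ydist_triangle u v w : ydist v w <= ydist v u + ydist u w.
Proof.
rewrite -big_split /=; apply: leq_sum => i _.
by case: (i \in val v); case: (i \in val u); case: (i \in val w).
Qed.

Lemma ydist_compl v w : ydist (compl v) w + ydist v w = 2 * k - 1.
Proof.
rewrite -big_split /= (eq_bigr (fun=> 1)) => [|i _].
  by rewrite sum1_card cardC1 card_ord subn1.
by rewrite inE; case: (i \in val v); case: (i \in val w).
Qed.

(** The full symmetric difference of two k-sets has 2 (k - |v :&: w|)
    elements; the first summand is the contribution of the point 1.  So the
    parity of [ydist] tells whether v and w lie in the same layer. *)
Lemma ydist_card v w :
  ((one \in val v) (+) (one \in val w)) + ydist v w + 2 * #|val v :&: val w|
    = 2 * k.
Proof.
rewrite /ydist -(bigD1 one (P := predT)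
  (F := fun i => (i \in val v) (+) (i \in val w) : nat)) //=.
transitivity (#|val v| + #|val w|); last by rewrite !card_vertex addnn mul2n.
rewrite !card_sum_mem big_distrr -!big_split /=; apply: eq_bigr => i _.
by rewrite inE; case: (i \in val v); case: (i \in val w).
Qed.

Lemma HS_ydist v w : HS v w = (ydist v w == 1).
Proof.
rewrite /HS !contains1E; have := ydist_card v w.
by case: (_ (+) _) => /= ?; rewrite ?andbT ?andbF; lia.
Qed.

Lemma compl_ydist v w : (w == compl v) = (ydist v w == 2 * k - 1).
Proof.
apply/eqP/eqP => [->|vw].
  have := ydist_compl v (compl v); suff -> : ydist (compl v) (compl v) = 0 by [].
  by apply: big1 => i _; rewrite addbb.
have disj : #|val v :&: val w| = 0.
  by have := ydist_card v w; rewrite vw; case: (_ (+) _) => /=; lia.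
apply/val_inj/eqP; rewrite eqEcard (eqP (card_compl v)) card_vertex leqnn andbT.
by rewrite -disjoints_subset -setI_eq0 setIC -cards_eq0 disj.
Qed.

Lemma complK : involutive compl.
Proof. by move=> v; apply: val_inj; rewrite /= setCK. Qed.

Lemma FHSE v w : FHS v w = HS v w || (w == compl v).
Proof. by []. Qed.

Lemma ydist_eq0 v w : (ydist v w == 0) = (v == w).
Proof.
have -> : (v == w) = (w == compl (compl v)) by rewrite complK eq_sym.
by rewrite compl_ydist; have := ydist_compl v w; lia.
Qed.

(** * Complementarity from the distance of HS *)

(** To approach w from v one must move the point 1 in or out of v, and exchange
    it for a point x on which v and w disagree.  Such an x exists because two
    distinct k-sets have points on either side of their difference. *)
Lemma HS_approach v w :
  0 < ydist v w -> exists2 u, HS v u & (ydist u w).+1 = ydist v w.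
Proof.
rewrite lt0n ydist_eq0 => neq_vw.
have [x xv xw] : exists2 x, (x \in val v) = ~~ (one \in val v)
                          & (x \in val w) = (one \in val v).
  have not_sub (a b : hs_vertex k) :
      a != b -> exists2 x, x \in val a & x \notin val b.
    move=> neq_ab; apply/subsetPn; apply: contra neq_ab => sub_ab.
    by apply/eqP/val_inj/eqP; rewrite eqEcard sub_ab !card_vertex leqnn.
  case: (one \in val v).
    rewrite eq_sym in neq_vw.
    by have [x xw /negPf xv] := not_sub _ _ neq_vw; exists x.
  by have [x xv /negPf xw] := not_sub _ _ neq_vw; exists x.
have x1 : x != one by apply/eqP => x1; move: xv; rewrite x1; case: (_ \in _).
pose U := [set i | (i \in val v) (+) ((i == one) || (i == x))].
have cardU : #|U| == k.
  apply/eqP; transitivity #|val v|; last exact: card_vertex.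
  rewrite !card_sum_mem (bigD1 one) //= (bigD1 x) //=.
  rewrite [RHS](bigD1 one) //= [X in _ = _ + X](bigD1 x) //= !addnA.
  congr (_ + _).
    by rewrite !inE !eqxx orbT xv; case: (one \in val v).
  by apply: eq_bigr => i /andP[/negPf i1 /negPf ix]; rewrite inE i1 ix addbF.
pose u : hs_vertex k := exist _ U cardU; exists u.
  rewrite HS_ydist /ydist (bigD1 x) //= big1 => [|i /andP[/negPf i1 /negPf ix]].
    by rewrite inE eqxx orbT; case: (x \in val v).
  by rewrite inE i1 ix addbF addbb.
rewrite /ydist (bigD1 x) //= [RHS](bigD1 x) //= inE eqxx orbT xv xw -add1n addnA.
congr (_ + _); first by case: (one \in val v).
by apply: eq_bigr => i /andP[/negPf i1 /negPf ix]; rewrite inE i1 ix addbF.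
Qed.

Lemma HS_geodesic v w : exists p,
  [/\ path (@HS k) v p, last v p = w & size p = ydist v w].
Proof.
move: {2}(ydist v w) (erefl (ydist v w)) => n.
elim: n v => [|n IHn] v vw.
  by exists [::]; split=> //=; apply/eqP; rewrite -ydist_eq0 vw.
have [|u vu uw] := @HS_approach v w; first by rewrite vw.
have [|p [u_p p_w size_p]] := IHn u; first by move: uw; rewrite vw => -[].
by exists (u :: p); split; rewrite /= ?vu ?size_p.
Qed.

Lemma ydist_path v p : path (@HS k) v p -> ydist v (last v p) <= size p.
Proof.
elim: p v => [|u p IHp] v /=; first by rewrite leqn0 ydist_eq0.
case/andP=> vu /IHp u_p; apply: leq_trans (ydist_triangle u v _) _.
by move: vu; rewrite HS_ydist => /eqP->.
Qed.

(** In the cube of subsets of Y, 2k - 1 is the diameter and only antipodes are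
    that far apart. *)
Lemma compl_HS_distance v w :
  w == compl v <->
  (forall p, path (@HS k) v p -> last v p = w -> 2 * k - 1 <= size p).
Proof.
rewrite compl_ydist; split=> [/eqP<- p v_p <-|far]; first exact: ydist_path.
have [p [v_p p_w size_p]] := HS_geodesic v w.
by have := far p v_p p_w; have := ydist_compl v w; rewrite size_p; lia.
Qed.

Lemma HS_aut_compl s : s \in graph_aut (@HS k) ->
  forall v w, (s w == compl (s v)) = (w == compl v).
Proof.
move=> sA v w; move: s sA v w.
apply: (@graph_aut_invariant _ _ (fun v w => w == compl v)) => s sA v w.
move=> /compl_HS_distance far; apply/compl_HS_distance => p v_p p_w.
have sVA : (s^-1)%g \in graph_aut (@HS k) by rewrite groupV.
rewrite -(size_map (s^-1)%g); apply: far.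
  by rewrite -{1}(permK s v) graph_aut_path.
by rewrite -{1}(permK s v) last_map p_w permK.
Qed.

(** * Complementarity from the 4-cycles of FHS *)

Lemma card_vertexD1 u : one \in val u -> #|val u :\ one| = k - 1.
Proof.
move=> one_u; have := cardsD1 one (val u); rewrite one_u card_vertex => card_u.
by apply: etrans (esym (addKn 1 _)) _; rewrite -card_u.
Qed.

(** Along an HS-edge leaving a vertex that contains 1, only 1 is removed. *)
Lemma HS_setD1_subset u t : HS u t -> one \in val u ->
  one \notin val t /\ val u :\ one \subset val t.
Proof.
rewrite /HS !contains1E => /andP[/eqP card_ut sides] one_u.
have one_t : one \notin val t by move: sides; rewrite one_u; case: (_ \in _).
split=> //; have sub : val u :&: val t \subset val u :\ one.
  apply/subsetP=> i /setIP[iu it]; rewrite !inE iu andbT.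
  by apply: contraNneq one_t => <-.
have card_u1 := card_vertexD1 one_u.
have /eqP<- : val u :&: val t == val u :\ one by rewrite eqEcard sub card_u1 card_ut /=.
exact: subsetIr.
Qed.

(** If u and w contain 1, a common neighbour contains both of them minus 1, and
    this union already has k elements; otherwise the neighbour minus 1 lies in
    the intersection of u and w, which has only k - 1 elements. *)
Lemma HS_common_neighbour_unique u w v t : ydist u w = 2 ->
  HS u v -> HS w v -> HS u t -> HS w t -> t = v.
Proof.
move=> uw uv wv ut wt.
have [card_uw one_uw] : #|val u :&: val w| = k - 1
    /\ (one \in val u) = (one \in val w).
  have := ydist_card u w; rewrite uw.
  by case: (one \in val u); case: (one \in val w) => /= ?; split=> //; lia.
have [one_u|one_u] := boolP (one \in val u).
  have one_w : one \in val w by rewrite -one_uw.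
  have cardU : #|(val u :|: val w) :\ one| = k.
    have cardE := cardsD1 one (val u :|: val w).
    rewrite inE one_u cardsU card_uw !card_vertex in cardE.
    by apply: etrans (esym (addKn 1 _)) _; rewrite -cardE; lia.
  have nbr x : HS u x -> HS w x -> (val u :|: val w) :\ one = val x.
    move=> ux wx; apply/eqP; rewrite eqEcard cardU card_vertex leqnn andbT.
    have [_ su] := HS_setD1_subset ux one_u; have [_ sw] := HS_setD1_subset wx one_w.
    by rewrite setDUl subUset su sw.
  by apply: val_inj; rewrite -(nbr t) // -(nbr v).
have nbr x : HS u x -> HS w x -> one |: (val u :&: val w) = val x.
  move=> ux wx; have one_x : one \in val x.
    by move: ux; rewrite /HS !contains1E (negPf one_u) => /andP[].
  rewrite HS_sym in ux; rewrite HS_sym in wx.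
  have [_ xu] := HS_setD1_subset ux one_x; have [_ xw] := HS_setD1_subset wx one_x.
  rewrite -(setD1K one_x); congr (_ |: _).
  apply/esym/eqP; rewrite eqEcard subsetI xu xw card_uw /=.
  by rewrite (card_vertexD1 one_x) leqnn.
by apply: val_inj; rewrite -(nbr t) // -(nbr v).
Qed.

(** Every further edge at v forms a 4-cycle with the complementary edge at v,
    whereas for k > 2 some HS-edges at v lie in no 4-cycle with a given HS-edge
    v w. *)
Lemma compl_FHS_squares v w : 2 < k ->
  w == compl v <->
  (FHS v w /\ forall u, FHS v u -> u != w ->
     exists t, [/\ t != v, FHS u t & FHS w t]).
Proof.
move=> k_gt2; split=> [/eqP->|[vw squares]].
  split=> [|u]; first by rewrite FHSE eqxx orbT.
  rewrite FHSE => /orP[vu|/eqP->]; last by rewrite eqxx.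
  move=> neq_u; exists (compl u); split.
  - by apply: contra neq_u => /eqP<-; rewrite complK.
  - by rewrite FHSE eqxx orbT.
  rewrite FHSE HS_ydist; apply/orP; left; move: vu; rewrite HS_ydist.
  have := ydist_compl v (compl u); have := ydist_compl u v.
  by rewrite (ydistC v (compl u)) (ydistC v u); lia.
apply/idPn=> not_compl; move: vw; rewrite FHSE (negPf not_compl) orbF => vw.
(* Moving from v towards the complement of w is moving away from w. *)
have dist_cw x : ydist x (compl w) + ydist x w = 2 * k - 1.
  by rewrite ydistC (ydistC x w) ydist_compl.
have dist_vw : ydist v w = 1 by apply/eqP; rewrite -HS_ydist.
have [|u vu ucw] := @HS_approach v (compl w); first by have := dist_cw v; lia.
have dist_uw : ydist u w = 2 by have := dist_cw v; have := dist_cw u; lia.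
have neq_uw : u != w by rewrite -ydist_eq0 dist_uw.
have [|t [neq_tv]] := squares u _ neq_uw; first by rewrite FHSE vu.
rewrite !FHSE => /orP[ut|/eqP->] /orP[wt|/eqP tw].
- case/eqP: neq_tv; apply: (HS_common_neighbour_unique dist_uw) => //.
    by rewrite HS_sym.
  by rewrite HS_sym.
- by move: ut; rewrite tw HS_ydist; have := dist_cw u; lia.
- by move: wt; rewrite HS_sym HS_ydist; have := ydist_compl u w; lia.
- by case/eqP: neq_uw; apply: (can_inj complK).
Qed.

Lemma FHS_aut_compl s : 2 < k -> s \in graph_aut (@FHS k) ->
  forall v w, (s w == compl (s v)) = (w == compl v).
Proof.
move=> k_gt2 sA v w; move: s sA v w.
apply: (@graph_aut_invariant _ _ (fun v w => w == compl v)) => s.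
move=> /graph_autP sA v w.
move=> /(compl_FHS_squares _ _ k_gt2)[vw squares].
apply/(compl_FHS_squares _ _ k_gt2); split=> [|u]; first by rewrite sA.
rewrite -(permKV s u) sA (inj_eq perm_inj) => vu neq_u.
have [t [neq_t ut wt]] := squares _ vu neq_u.
by exists (s t); rewrite !sA (inj_eq perm_inj).
Qed.

(** * Equality of the automorphism groups *)

Lemma HSE v w : 1 < k -> HS v w = FHS v w && (w != compl v).
Proof.
move=> k_gt1; rewrite FHSE; case: (w =P compl v) => [->|_]; last by rewrite orbF andbT.
by rewrite andbF HS_ydist; have := compl_ydist v (compl v); rewrite eqxx; lia.
Qed.

End HyperStar.

Theorem theorem3p1 (k : nat) (hk : 2 < k) :
  graph_aut (@FHS k) = graph_aut (@HS k).
Proof.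
have k_gt0 : 0 < k by lia.
have k_gt1 : 1 < k by lia.
apply/val_inj/setP => s; apply/idP/idP => sA; apply/graph_autP => v w.
  by rewrite !(HSE k_gt0) // (FHS_aut_compl _ hk sA) (graph_autP _ _ sA).
by rewrite !(FHSE k_gt0) (HS_aut_compl _ sA) (graph_autP _ _ sA).
Qed.
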